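(* Let $G=(V,E)$ be a finite, connected, regular and bipartite graph with $V=[m]=\{1,\dots,m\}$ and bipartition $V=A\cup B$. Let $$\Omega=\{(x_1,\dots,x_m)\in\mathbb{R}^m:\ \exists\, p,q\ge 0,\ p+q=2/m,\ \text{such that } x_i=p \text{ for all } i\in A \text{ and } x_i=q \text{ for all } i\in B\}.$$ Then the vector of proportions of balls $x(n)=(x_1(n),\dots,x_m(n))$ of the urn process on $G$ almost surely converges, as $n\to\infty$, to a (possibly random) point of $\Omega$.
   Context: Urn process on $G$: let $G=(V,E)$ be a finite connected (simple) graph with $V=[m]$ and $|E|=N$. On each vertex $i$ there is a bin initially containing $B_i(0)\ge 1$ balls ($B_i(0)$ a deterministic integer). At each step $n\ge 1$, for each edge $\{i,j\}\in E$ one ball is added either to bin $i$ or to bin $j$; given the history up to step $n-1$, the conditional probability that the ball of edge $\{i,j\}$ is added to $i$ is $$\frac{B_i(n-1)}{B_i(n-1)+B_j(n-1)},$$ where $B_i(n-1)$ is the number of balls in bin $i$ after step $n-1$. Let $N_0=\sum_{i=1}^m B_i(0)$ and $$x_i(n)=\frac{B_i(n)}{N_0+nN},\qquad i\in[m],\qquad x(n)=(x_1(n),\dots,x_m(n)).$$ A graph is regular if all its vertices have the same degree. *)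

(* Defs.v *)
From mathcomp Require Import all_boot all_order all_algebra.

Set Implicit Arguments.
Unset Strict Implicit.
Unset Printing Implicit Defensive.

Definition edge (m : nat) (i j : 'I_m) : {set 'I_m} := [set i; j].

(* A simple graph on 'I_m is given by a symmetric irreflexive adjacency
   relation; its edges are unordered pairs. *)
Definition edges (m : nat) (adj : rel 'I_m) : {set {set 'I_m}} :=
  [set e : {set 'I_m} | [exists i, exists j, adj i j && (e == edge i j)]].

Definition simple_graph (m : nat) (adj : rel 'I_m) : Prop :=
  symmetric adj /\ irreflexive adj.

(* By convention a connected graph has at least one vertex. *)
Definition connected_graph (m : nat) (adj : rel 'I_m) : Prop :=
  (0 < m)%N /\ forall i j, connect adj i j.

Definition regular_graph (m : nat) (adj : rel 'I_m) : Prop :=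
  exists d : nat, forall i, #|[set j | adj i j]| = d.

Definition bipartition (m : nat) (adj : rel 'I_m) (A B : {set 'I_m}) : Prop :=
  [/\ A :|: B = [set: 'I_m], A :&: B = set0 &
      forall i j, adj i j -> (i \in A) && (j \in B) || (i \in B) && (j \in A)].

(* [X k e w] is the endpoint of [e] whose bin receives the ball of [e] at step
   [k >= 1]; the values at step 0 and on non-edges are never used. *)
Definition balls (m : nat) (adj : rel 'I_m) (T : Type) (B0 : 'I_m -> nat)
    (X : nat -> {set 'I_m} -> T -> 'I_m) (n : nat) (w : T) (i : 'I_m) : nat :=
  (B0 i + \sum_(1 <= k < n.+1) #|[set e in edges adj | X k e w == i]|)%N.

From mathcomp Require Import all_classical all_reals all_analysis.
Import Order.TTheory GRing.Theory Num.Theory.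
Import numFieldNormedType.Exports.

Local Open Scope classical_set_scope.
Local Open Scope ring_scope.

(* The sample points whose allocation of balls agrees with that of [w0] at
   steps 1, ..., n: as [w0] varies these sets are the atoms of the finite
   sigma-algebra generated by the process up to step n. *)
Definition history (m : nat) (adj : rel 'I_m) (T : Type)
    (X : nat -> {set 'I_m} -> T -> 'I_m) (n : nat) (w0 : T) : set T :=
  [set w | forall k e, (1 <= k <= n)%N -> e \in edges adj ->
                       X k e w = X k e w0].

Definition cond_prob (d : measure_display) (T : measurableType d)
    (R : realType) (P : probability T R) (E H : set T) : R :=
  fine (P (E `&` H)) / fine (P H).

(* Only the conditional law of each single edge is prescribed: the joint law of
   the balls of different edges within one step is arbitrary. *)
Record urn_process (m : nat) (adj : rel 'I_m) (d : measure_display)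
    (T : measurableType d) (R : realType) (P : probability T R)
    (B0 : 'I_m -> nat) (X : nat -> {set 'I_m} -> T -> 'I_m) : Prop := {
  urn_init : forall i, (1 <= B0 i)%N;
  urn_measurable : forall n e i, (1 <= n)%N -> e \in edges adj ->
    measurable [set w | X n e w = i];
  urn_endpoint : forall n e w, (1 <= n)%N -> e \in edges adj ->
    X n e w \in e;
  urn_law : forall n i j w0, adj i j ->
    P (history adj X n w0) != 0%E ->
    cond_prob P [set w | X n.+1 (edge i j) w = i] (history adj X n w0) =
    (balls adj B0 X n w0 i)%:R /
    (balls adj B0 X n w0 i + balls adj B0 X n w0 j)%N%:R
}.

Definition proportions (m : nat) (adj : rel 'I_m) (T : Type) (R : realType)
    (B0 : 'I_m -> nat) (X : nat -> {set 'I_m} -> T -> 'I_m)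
    (n : nat) (w : T) : 'rV[R]_m :=
  \row_i ((balls adj B0 X n w i)%:R /
          (\sum_(j < m) B0 j + n * #|edges adj|)%N%:R).

Definition Omega (m : nat) (R : realType) (A B : {set 'I_m}) : set 'rV[R]_m :=
  [set x : 'rV[R]_m | exists p q : R, [/\ 0 <= p, 0 <= q, p + q = 2 / m%:R,
     forall i, i \in A -> x 0 i = p & forall i, i \in B -> x 0 i = q]].

(* Main.v *)
(* Write x_i = B_i / S with S the total number of balls. In a regular bipartite
   graph every edge has exactly one end in A, so the potential
     - \sum_(i in A) (ln B_i - N / B_i - ln S) >= 0
   decreases in conditional expectation by at least a multiple of
     (1 / S) \sum_edges (x_i + x_j - 2 / m)^2,
   the term N / B_i turning the second-order error of the logarithm into an
   exact inequality. A nonnegative supermartingale converges almost surely, so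
   \sum_A ln x_i converges, which keeps the x_i with i in A away from 0; and the
   decrements are summable, which, the x_i varying slowly, forces x_i + x_j to
   tend to 2 / m along every edge. By connectedness the x_i with i in A share a
   common limit p, read off from \sum_A ln x_i, and the others tend to
   2 / m - p. *)
Require Import Defs.
From mathcomp Require Import all_boot all_order all_algebra.
From mathcomp Require Import ring lra.
From mathcomp Require Import all_classical all_reals all_analysis.
Import Order.TTheory GRing.Theory Num.Theory.
Import numFieldNormedType.Exports.
Local Open Scope classical_set_scope.
Local Open Scope ring_scope.

Set Implicit Arguments.
Unset Strict Implicit.
Unset Printing Implicit Defensive.

(** * Real sequences *)

(** The limit is the supremum of the numbers that [z] eventually exceeds, that is, the lower limit,
    finite because of [K]. Intervals of the grids of mesh [1 / l.+1] suffice, so that only countably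
    many almost sure events will have to be combined. *)
Lemma grid_crossings_cvg (R : realType) (z : nat -> R) (K : R) :
  (forall n, 0 <= z n) -> ~ (\forall n \near \oo, K < z n) ->
  (forall k l : nat, (\forall n \near \oo, z n < k.+1%:R / l.+1%:R) \/
                     (\forall n \near \oo, k%:R / l.+1%:R < z n)) ->
  cvgn z.
Proof.
move=> z0 zK cross.
pose E : set R := [set r | \forall n \near \oo, r < z n].
have E_neg e : 0 < e -> E (- e).
  by move=> e0; apply: nearW => n; apply: lt_le_trans (z0 n); rewrite oppr_lt0.
have ubE : ubound E K.
  move=> r Er; rewrite leNgt; apply/negP => Kr; apply: zK.
  by apply: filterS Er => n; apply: lt_trans.
have supE : has_sup E by split; [exists (- 1); exact: E_neg | exists K].
have hubE : has_ubound E by exists K.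
have L0 : 0 <= sup E.
  apply/ler_addgt0Pr => e e0; rewrite -lerBlDr sub0r.
  by apply: ub_le_sup => //; exact: E_neg.
apply: (cvgP (sup E)); apply/cvgrPdist_lt => e e0.
have [r Er Lr] := sup_adherent e0 supE.
have [l le] : exists l : nat, l.+1%:R^-1 < e / 2.
  exists (Num.trunc (e / 2)^-1).
  by rewrite invf_plt ?posrE ?ltr0Sn ?divr_gt0// truncnS_gt.
have l0 : 0 < l.+1%:R :> R by [].
have [t /andP[kle klt]] : exists t : nat, t%:R <= sup E * l.+1%:R < t.+1%:R.
  by exists (Num.trunc (sup E * l.+1%:R)); apply/truncn_itv/mulr_ge0/ltW.
(* [k / l.+1] is the first grid point strictly above [sup E], so [z] cannot eventually stay above
   it. Hence [z] is eventually below the next grid point, which is at most [sup E + 2 / l.+1]. *)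
pose k := t.+1.
have upper : \forall n \near \oo, z n < sup E + e.
  have [up|low] := cross k l.
    apply: filterS up => n /lt_le_trans; apply.
    apply: (@le_trans _ _ (sup E + 2 * l.+1%:R^-1)).
      rewrite ler_pdivrMr// (_ : (sup E + _) * _ = sup E * l.+1%:R + 2).
        2: by rewrite mulrDl -mulrA mulVf ?mulr1 ?gt_eqF.
      have -> : k.+1%:R = t%:R + 2 :> R by rewrite /k -addn2 natrD.
      by rewrite lerD2r.
    by rewrite lerD2l mulrC -ler_pdivlMr// ltW.
  exfalso; have : k%:R / l.+1%:R <= sup E := ub_le_sup hubE low.
  by rewrite ler_pdivrMr// leNgt klt.
apply: filterS2 Er upper => n rz zu; rewrite ltr_distlC zu andbT; lra.
Qed.

Lemma near_series_le_cvg (R : realType) (u v : nat -> R) :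
  (forall n, 0 <= u n) -> (forall n, 0 <= v n) ->
  (\forall n \near \oo, u n <= v n) -> cvgn (series v) -> cvgn (series u).
Proof.
move=> u0 v0 [N _ uv] cv.
pose u' n := if (n < N)%N then 0 else u n.
have : cvgn (series u').
  apply: (series_le_cvg _ v0 _ cv) => n; rewrite /u'; case: ltnP => // Nn.
  exact: uv.
have E : [sequence \sum_(N <= k < n) u' k]_n = [sequence \sum_(N <= k < n) u k]_n.
  apply/funext => n; apply: eq_big_nat => k /andP[Nk _].
  by rewrite /u' ltnNge Nk.
by rewrite -(is_cvg_series_restrict N u') E is_cvg_series_restrict.
Qed.

(* The increments of [z ^ 3] are absolutely summable, so [z ^ 3] converges. *)
Lemma cvg0_of_slow_increments (R : realType) (z s : nat -> R) (C : R) :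
  (forall n, 0 < s n) -> (forall n, s n <= s n.+1) ->
  (forall n, `|z n.+1 - z n| <= C / s n.+1) ->
  cvgn (series (fun n => z n ^+ 2 / s n)) ->
  ~ cvgn (series (fun n => (s n)^-1)) -> z @ \oo --> (0 : R).
Proof.
move=> s0 sS dz cz ds.
have C0 : 0 <= C.
  by have := le_trans (normr_ge0 _) (dz 0%N); rewrite pmulr_lge0// invr_gt0.
have pos_t n : 0 <= z n ^+ 2 / s n by rewrite divr_ge0 ?sqr_ge0// ltW.
have cz1 : cvgn (series (fun n => z n.+1 ^+ 2 / s n.+1)).
  have /cvg_ex[l] : cvgn (series (fun n => z n ^+ 2 / s n)) by [].
  rewrite -cvg_shiftS => cl; apply/cvg_ex; exists (l - z 0%N ^+ 2 / s 0%N).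
  rewrite (_ : series _ = fun n => series (fun n => z n ^+ 2 / s n) n.+1
      - z 0%N ^+ 2 / s 0%N); first exact: cvgB cl (cvg_cst _).
  apply/funext => n; rewrite /series/= big_nat_recl// addrC addrA addNr add0r.
  by [].
have c3 : cvgn (fun n => z n ^+ 3).
  have abs : cvgn (series (telescope (fun n => z n ^+ 3))).
    apply: normed_cvg.
    (* From [|a^3 - b^3| <= |a - b| * 3/2 * (a^2 + b^2)]; as [s] is nondecreasing,
       [z n ^+ 2 / s n.+1] is at most [z n ^+ 2 / s n]. *)
    pose v n := 3 / 2 * C * (z n ^+ 2 / s n + z n.+1 ^+ 2 / s n.+1).
    have cv : cvgn (series v).
      by apply: (@is_cvg_seriesZ _ (_ \+ _)); exact: is_cvg_seriesD.
    apply: series_le_cvg cv => n; first exact: normr_ge0.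
      by rewrite /v mulr_ge0//; [rewrite mulr_ge0// divr_ge0 | rewrite addr_ge0].
    rewrite /v /telescope /=.
    have -> : z n.+1 ^+ 3 - z n ^+ 3 =
      (z n.+1 - z n) * (z n.+1 ^+ 2 + z n.+1 * z n + z n ^+ 2) by ring.
    rewrite normrM.
    apply: (@le_trans _ _
      (C / s n.+1 * (3 / 2 * (z n ^+ 2 + z n.+1 ^+ 2)))).
      have sqB := sqr_ge0 (z n.+1 - z n); have sqD := sqr_ge0 (z n.+1 + z n).
      by apply: ler_pM => //; rewrite ger0_norm; nra.
    rewrite (_ : 3 / 2 * C * _ = C * (3 / 2 *
      (z n ^+ 2 / s n + z n.+1 ^+ 2 / s n.+1))); last by ring.
    rewrite -mulrA ler_wpM2l// mulrCA ler_wpM2l ?divr_ge0// mulrDr.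
    rewrite !(mulrC (s n.+1)^-1) lerD2r ler_wpM2l ?sqr_ge0//.
    by rewrite lef_pV2 ?posrE.
  have /cvg_ex[l cl] := abs; apply/cvg_ex; exists (z 0%N ^+ 3 + l).
  rewrite (_ : (fun n => _) = fun n => z 0%N ^+ 3 +
      series (telescope (fun n => z n ^+ 3)) n).
    exact: cvgD (cvg_cst _) cl.
  by apply/funext => n; rewrite -eq_sum_telescope.
have /cvg_ex[/= L cL] := c3.
have [L0|/eqP L0] := eqVneq L 0; last first.
  exfalso; apply: ds.
  have h0 : 0 < `|L| / 2 by rewrite divr_gt0// normr_gt0; exact/eqP.
  (* Capping at 1 lets [h <= |z|^3] imply [h <= z^2] whether [|z|] is below or above 1. Then [1 / s]
     is eventually dominated by the summable [h^-1 * z^2 / s]. *)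
  pose h := Num.min (`|L| / 2) 1.
  have hh : 0 < h by rewrite lt_min h0 ltr01.
  apply: (@near_series_le_cvg _ _ (fun n => h^-1 * (z n ^+ 2 / s n))).
  - by move=> n; rewrite invr_ge0 ltW.
  - by move=> n; rewrite mulr_ge0// invr_ge0 ltW.
  - have /cvgrPdist_lt/(_ _ h0) cL' := cL.
    apply: filterS cL' => n Ln.
    have h3 : h <= `|z n| ^+ 3.
      apply: (@le_trans _ _ (`|L| / 2)); first by rewrite ge_min lexx.
      rewrite -normrX; have := ler_normD (L - z n ^+ 3) (z n ^+ 3).
      by rewrite subrK => ?; lra.
    have h2 : h <= z n ^+ 2.
      rewrite -(real_normK (num_real (z n))); have [le1|/ltW ge1] := leP `|z n| 1.
        apply: (le_trans h3); rewrite exprS.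
        by rewrite ler_piMl// ?exprn_ge0.
      apply: (@le_trans _ _ 1); first by rewrite ge_min lexx orbT.
      by rewrite exprn_ege1.
    rewrite mulrA ler_peMl// ?invr_ge0 ?(ltW (s0 n))//.
    by rewrite mulrC ler_pdivlMr// mul1r.
  - exact: (@is_cvg_seriesZ _ (fun n => z n ^+ 2 / s n)).
apply/cvgrPdist_lt => e e0.
have e30 : 0 < e ^+ 3 by rewrite exprn_gt0.
have /cvgrPdist_lt/(_ _ e30) := cL; rewrite L0.
apply: filterS => n; rewrite !sub0r !normrN normrX.
by rewrite ltr_pXn2r// nnegrE ltW.
Qed.

(** * Estimates for the logarithm *)

Lemma ln_increment_le (R : realType) (a b : R) :
  0 < a -> 0 < b -> ln b - ln a <= (b - a) / a.
Proof.
move=> a0 b0; rewrite -ln_div ?posrE//.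
have -> : b / a = 1 + (b - a) / a by rewrite mulrBl divff ?gt_eqF// addrC subrK.
by apply: le_ln1Dx; rewrite mulrBl divff ?gt_eqF// ltrBrDl subrr divr_gt0.
Qed.

(* The correction [- K / b] absorbs the second-order term of the logarithm. *)
Lemma corrected_ln_increment_ge (R : realType) (K b D : R) :
  0 < b -> 0 <= D <= K -> D / b <= (ln (b + D) - K / (b + D)) - (ln b - K / b).
Proof.
move=> b0 /andP[D0 DK].
have bD0 : 0 < b + D by lra.
have := ln_increment_le bD0 b0.
have -> : (b - (b + D)) / (b + D) = - (D / (b + D)) by rewrite -mulNr;
  congr (_ / _); ring.
move=> ln_ge.
(* The logarithm alone loses [D^2 / (b (b + D))], while the correction gains [K D / (b (b + D))],
   which is at least as much since [D <= K]. *)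
suff : D / b <= D / (b + D) + (K / b - K / (b + D)) by lra.
have -> : D / (b + D) + (K / b - K / (b + D)) = D / b + D * (K - D) / (b * (b + D)).
  by field; rewrite !gt_eqF.
rewrite lerDl divr_ge0//; first by rewrite mulr_ge0// subr_ge0.
by rewrite mulr_ge0// ltW.
Qed.

Lemma ln_lipschitz (R : realType) (e a b : R) : 0 < e -> e <= a -> e <= b ->
  `|ln a - ln b| <= `|a - b| / e.
Proof.
move=> e0 ea eb.
have half u v : e <= u -> e <= v -> ln v - ln u <= `|u - v| / e.
  move=> eu ev; have u0 := lt_le_trans e0 eu.
  apply: (le_trans (ln_increment_le u0 (lt_le_trans e0 ev))).
  apply: (@le_trans _ _ (`|u - v| / u)).
    by rewrite ler_pM2r ?invr_gt0// distrC ler_norm.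
  by rewrite ler_wpM2l// lef_pV2 ?posrE.
rewrite ler_norml lerNl opprB half//=.
by rewrite distrC half.
Qed.

(** * Functions of a finite random variable *)

(** Stands for measurability with respect to the sigma-algebra generated by [F]. Below [F] takes
    finitely many values, and constancy on its fibres is then all that is required. *)
Definition adapted (T K U : Type) (F : T -> K) (f : T -> U) : Prop :=
  forall w w', F w = F w' -> f w = f w'.

Lemma adapted_trans (T K L U : Type) (F : T -> K) (G : T -> L) (f : T -> U) :
  adapted G F -> adapted F f -> adapted G f.
Proof. by move=> GF Ff w w' /GF/Ff. Qed.

Section finite_information.
Context {d : measure_display} {T : measurableType d} {R : realType}.
Variables (P : probability T R) (K : finType) (F : T -> K).
Hypothesis mF : forall k, measurable [set w | F w = k].

Lemma adapted_factor (f : T -> R) : adapted F f -> exists g, forall w, f w = g (F w).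
Proof.
move=> Ff.
(* A preimage is chosen for each value of [F]; the default 0 is taken only off the range of [F]. *)
exists (fun k => if pselect (exists w, F w = k) is left h then f (projT1 (cid h)) else 0).
move=> w; case: pselect => [h|[]]; last by exists w.
by case: cid => w' /= /Ff.
Qed.

Lemma adapted_measurable (f : T -> R) : adapted F f -> measurable_fun setT f.
Proof.
move=> /adapted_factor[g fg] _ Y _; rewrite setTI.
rewrite (_ : _ @^-1` _ = \bigcup_(k in [set k | Y (g k)]) [set w | F w = k]).
  by apply: fin_bigcup_measurable => //; exact: finite_finset.
apply/seteqP; split => w /=; rewrite fg; first by move=> ?; exists (F w).
by move=> [k Yk Fwk]; rewrite Fwk.
Qed.

Lemma adapted_integrable (f : T -> R) : adapted F f -> P.-integrable setT (EFin \o f).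
Proof.
move=> Ff; apply: measurable_bounded_integrable => //.
- by rewrite -ge0_fin_numE ?fin_num_measure.
- exact: adapted_measurable.
- have [g fg] := adapted_factor Ff.
  exists (\sum_k `|g k|); split; first exact: num_real.
  move=> x gx w _ /=; rewrite fg; apply: le_trans (ltW gx).
  by rewrite (bigD1 (F w))//= lerDl sumr_ge0.
Qed.

End finite_information.

Section Rintegral_sums.
Context {d : measure_display} {T : measurableType d} {R : realType}.
Variables (P : probability T R) (I : Type) (r : seq I) (p : pred I) (f : I -> T -> R).
Hypothesis intf : forall i, P.-integrable setT (EFin \o f i).

Lemma integrable_EFin_sum :
  P.-integrable setT (EFin \o (fun w => \sum_(i <- r | p i) f i w)).
Proof.
have := integrable_sum measurableT r (fun i (_ : p i) => intf i).
by apply: eq_integrable => // w _ /=; rewrite sumEFin.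
Qed.

Lemma Rintegral_sum :
  \int[P]_w (\sum_(i <- r | p i) f i w) = \sum_(i <- r | p i) \int[P]_w f i w.
Proof.
rewrite /Rintegral -[RHS]/(fine (_)%:E) -sumEFin; congr fine.
under eq_integral do rewrite -sumEFin.
rewrite integral_sum//; apply: eq_bigr => i _; rewrite fineK//.
by apply: integrable_fin_num => //; exact: intf.
Qed.

End Rintegral_sums.

(** The fibres of [F] form a finite measurable partition. This plays the role of the tower property:
    a conditional law given on atoms is integrated over the whole space. *)
Lemma eq_Rintegral_atoms {d} {T : measurableType d} {R : realType}
    (P : probability T R) (K : finType) (F : T -> K) (f g : T -> R) :
  (forall k, measurable [set w | F w = k]) ->
  P.-integrable setT (EFin \o f) -> P.-integrable setT (EFin \o g) ->
  (forall k, \int[P]_(w in [set w | F w = k]) f w = \int[P]_(w in [set w | F w = k]) g w) ->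
  \int[P]_w f w = \int[P]_w g w.
Proof.
move=> mF intf intg fg.
have atoms h : P.-integrable setT (EFin \o h) ->
    \int[P]_w h w = \sum_k \int[P]_(w in [set w | F w = k]) h w.
  move=> inth; under [RHS]eq_bigr do rewrite Rintegral_mkcond.
  rewrite -Rintegral_sum.
    apply: eq_Rintegral => w _; rewrite (bigD1 (F w))//= big1 ?addr0.
      by rewrite patchE ifT// inE.
    by move=> k /eqP kF; rewrite patchE ifF//; apply/negP; rewrite inE => /esym.
  move=> k; rewrite -restrict_EFin.
  have /(integrable_mkcond _ (mF k)) := integrableS measurableT (mF k) (@subsetT _ _) inth.
  exact.
by rewrite !atoms//; apply: eq_bigr.
Qed.

(** By monotone convergence the sum of the series has integral at most [C], hence it is almost
    everywhere finite. *)
Lemma ae_cvg_series {d} {T : measurableType d} {R : realType}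
    (P : probability T R) (f : nat -> T -> R) (C : R) :
  (forall n, P.-integrable setT (EFin \o f n)) -> (forall n w, 0 <= f n w) ->
  (forall n, \sum_(k < n) \int[P]_w f k w <= C) ->
  {ae P, forall w, cvgn (series (f ^~ w))}.
Proof.
move=> intf f0 fC.
have mf n := measurable_int P (intf n).
pose S w := (\sum_(0 <= k <oo) (f k w)%:E)%E.
have S0 w : (0 <= S w)%E by apply: nneseries_ge0 => k _ _; rewrite lee_fin.
have SC : (\int[P]_w S w <= C%:E)%E.
  rewrite integral_nneseries//; last by move=> n w _; rewrite lee_fin.
  apply: lime_le.
    apply: is_cvg_nneseries => n _ _; apply: integral_ge0 => w _.
    by rewrite lee_fin.
  apply: nearW => n; rewrite big_mkord.
  rewrite (_ : (\sum_(i < n) _)%E = (\sum_(i < n) \int[P]_w f i w)%:E) ?lee_fin//.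
  rewrite -sumEFin; apply: eq_bigr => i _; rewrite fineK//.
  by apply: integrable_fin_num => //; exact: intf.
have intS : P.-integrable setT S.
  apply/integrableP; split.
    apply: (@ge0_emeasurable_sum _ _ _ _ (fun n w => (f n w)%:E) xpredT) => //.
    + by move=> n w _ _; rewrite lee_fin.
    + by move=> n _; exact: mf.
  apply: le_lt_trans (ltry C).
  by under eq_integral do rewrite gee0_abs//.
have := integrable_ae measurableT intS.
apply: filterS => w /(_ I) Sfin.
apply: nondecreasing_is_cvgn.
  apply/nondecreasing_seqP => n; rewrite /series/= big_nat_recr//= lerDl.
  exact: f0.
exists (fine (S w)) => _ [n _ <-].
rewrite -lee_fin fineK// -sumEFin.
by apply: nneseries_lim_ge => k _ _; rewrite lee_fin.
Qed.

(** * Convergence of nonnegative supermartingales *)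

(* The trader who holds one unit of [z] from each time it is at most [a] until
   the next time it is at least [b]. *)
Fixpoint holding (R : realType) (a b : R) (z : nat -> R) (n : nat) : bool :=
  if n is k.+1 then
    if holding a b z k then z k.+1 < b else z k.+1 <= a
  else z 0%N <= a.

Definition upcrosses (R : realType) (a b : R) (z : nat -> R) (n : nat) : bool :=
  holding a b z n && ~~ holding a b z n.+1.

Lemma eq_holding (R : realType) (a b : R) (z z' : nat -> R) (n : nat) :
  (forall k, (k <= n)%N -> z k = z' k) -> holding a b z n = holding a b z' n.
Proof.
elim: n => [|n IH] zz' /=; first by rewrite zz'.
by rewrite IH ?zz'// => k kn; apply: zz'; exact: leqW.
Qed.

(** Each completed purchase and sale earns at least [b - a]; a position still open was bought at a
    price at most [a] and is worth at least 0. *)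
Lemma upcrossing_gain (R : realType) (a b : R) (z : nat -> R) (n : nat) :
  0 <= a -> (forall n, 0 <= z n) ->
  (b - a) * (\sum_(k < n) (upcrosses a b z k)%:R) - a <=
  \sum_(k < n) (holding a b z k)%:R * (z k.+1 - z k).
Proof.
move=> a0 z0.
(* The induction must keep track of the current value of an open position, measured from [a]. *)
suff : (b - a) * (\sum_(k < n) (upcrosses a b z k)%:R) +
    (if holding a b z n then z n - a else 0) <=
    \sum_(k < n) (holding a b z k)%:R * (z k.+1 - z k).
  by apply: le_trans; have := z0 n; case: ifP => _ ?; lra.
elim: n => [|n IH]; first by rewrite !big_ord0 mulr0 add0r/=; case: ifP => ?; lra.
rewrite !big_ord_recr/= mulrDr /upcrosses/=.
move: IH; case: (holding a b z n) => /= IH.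
  have [zb|bz] := ltP (z n.+1) b => /=; lra.
by have [za|az] := leP (z n.+1) a => /=; lra.
Qed.

(** After the last upcrossing the trader either holds forever, and [z] stays below [b], or never
    buys again, and [z] stays above [a]. *)
Lemma finite_upcrossings_near (R : realType) (a b : R) (z : nat -> R) :
  cvgn (series (fun n => (upcrosses a b z n)%:R : R)) ->
  (\forall n \near \oo, z n < b) \/ (\forall n \near \oo, a < z n).
Proof.
(* The terms are 0 or 1 and tend to 0, so they vanish from some [N] on. *)
move=> /cvg_series_cvg_0/cvgrPdist_lt/(_ 1 ltr01)[N _ noup].
have {}noup n : (N <= n)%N -> holding a b z n -> holding a b z n.+1.
  move=> /noup; rewrite /mkset sub0r normrN normr_nat /upcrosses => + h.
  by rewrite h; case: (holding a b z n.+1) => //; rewrite ltxx.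
have [[M NM hM]|never] := pselect (exists2 M, (N <= M)%N & holding a b z M).
  left; exists M.+1 => // -[//|n] /= Mn.
  have hn : holding a b z n.
    rewrite -(subnKC (Mn : (M <= n)%N)); elim: (n - M)%N => [|k IH];
      first by rewrite addn0.
    by rewrite addnS noup// (leq_trans NM)// leq_addr.
  have := noup n (leq_trans NM Mn) hn.
  by rewrite /= hn.
right; exists N.+1 => // -[//|n] /= Nn.
have hn k : (N <= k)%N -> holding a b z k = false.
  by move=> Nk; apply/negP => hk; apply: never; exists k.
have := hn n.+1 (leqW Nn).
by rewrite /= (hn n Nn) => /negbT; rewrite -ltNge.
Qed.

(** By Fatou the lower limit has integral at most [C], so it is almost everywhere finite; without
    any such [K] it would be infinite. *)
Lemma ae_liminf_finite {d} {T : measurableType d} {R : realType}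
    (P : probability T R) (Z : nat -> T -> R) (C : R) :
  (forall n, P.-integrable setT (EFin \o Z n)) -> (forall n w, 0 <= Z n w) ->
  (forall n, \int[P]_w Z n w <= C) ->
  {ae P, forall w, exists K : R, ~ \forall n \near \oo, K < Z n w}.
Proof.
move=> intZ Z0 ZC.
have Z0' n w : setT w -> (0 <= (Z n w)%:E)%E by rewrite lee_fin.
have mZ n := measurable_int P (intZ n).
pose L w := limn_einf (fun n => (Z n w)%:E).
have L0 w : (0 <= L w)%E.
  rewrite /L limn_einf_lim; apply: lime_ge; first exact: is_cvg_einfs.
  by apply: nearW => n; apply: le_ereal_inf_tmp => _ [k _ <-]; rewrite lee_fin.
have LC : (\int[P]_w L w <= C%:E)%E.
  apply: (le_trans (fatou P measurableT mZ Z0')).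
  rewrite limn_einf_lim; apply: lime_le; first exact: is_cvg_einfs.
  apply: nearW => n.
  apply: (@le_trans _ _ (\int[P]_w (Z n w)%:E)%E).
    by apply: ereal_inf_lbound; exists n => /=.
  have := ZC n; rewrite -lee_fin fineK//.
  by apply: integrable_fin_num => //; exact: intZ.
have intL : P.-integrable setT L.
  apply/integrableP; split.
    apply: (measurable_realfun.emeasurable_fun_cvg (fun n w => einfs (fun k => (Z k w)%:E) n)).
      by move=> n; exact: measurable_realfun.measurable_fun_einfs.
    by move=> w _; rewrite /L limn_einf_lim; exact: is_cvg_einfs.
  apply: le_lt_trans (ltry C).
  by under eq_integral do rewrite gee0_abs//.
apply: filterS (integrable_ae measurableT intL) => w /(_ I) Lfin.
apply: contrapT => noK.
have : L w = +oo%E.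
  apply: (cvg_limn_einf_sup _).1; apply/cvgeryP/cvgryPgt => K.
  apply: contrapT => nK; apply: noK; exists K => nK'; exact: nK.
by move=> Lw; rewrite Lw in Lfin.
Qed.

Section supermartingale.
Context {d : measure_display} {T : measurableType d} {R : realType}.
Variables (P : probability T R) (K : nat -> finType) (F : forall n, T -> K n).
Hypothesis mF : forall n k, measurable [set w | F n w = k].
Hypothesis nondecreasingF : forall n, adapted (F n.+1) (F n).
Variable Z : nat -> T -> R.
Hypothesis adaptedZ : forall n, adapted (F n) (Z n).
Hypothesis Z_ge0 : forall n w, 0 <= Z n w.
(** The supermartingale inequality, tested against nonnegative functions of the past instead of
    being written with a conditional expectation. *)
Hypothesis superZ : forall n (f : T -> R), adapted (F n) f -> (forall w, 0 <= f w) ->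
  \int[P]_w (f w * (Z n.+1 w - Z n w)) <= 0.

Lemma adapted_leq (U : Type) (n k : nat) (f : T -> U) :
  (k <= n)%N -> adapted (F k) f -> adapted (F n) f.
Proof.
move=> /subnKC <-; elim: (n - k)%N => [|j IH]; first by rewrite addn0.
by rewrite addnS => /IH; apply: adapted_trans; exact: nondecreasingF.
Qed.

Lemma adapted_holding (a b : R) (n : nat) :
  adapted (F n) (fun w => holding a b (Z ^~ w) n).
Proof.
move=> w w' Fww'; apply: eq_holding => k kn.
exact: (adapted_leq kn (@adaptedZ k) Fww').
Qed.

(** Doob's upcrossing inequality: the decision to hold depends on the past only, so the expected
    gain of the trader is at most 0. With [upcrossing_gain] this bounds the expected number of
    upcrossings by [a / (b - a)]. *)
Lemma ae_finite_upcrossings (a b : R) : 0 <= a -> a < b ->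
  {ae P, forall w, cvgn (series (fun n => (upcrosses a b (Z ^~ w) n)%:R : R))}.
Proof.
move=> a0 ab.
have ad_gain n : adapted (F n.+1)
    (fun w => (holding a b (Z ^~ w) n)%:R * (Z n.+1 w - Z n w)).
  move=> w w' Fww'; congr ((nat_of_bool _)%:R * (_ - _)).
  - exact: (adapted_leq (leqnSn n) (@adapted_holding a b n) Fww').
  - exact: (adaptedZ Fww').
  - exact: (adapted_leq (leqnSn n) (@adaptedZ n) Fww').
have int_gain n := adapted_integrable P (@mF n.+1) (ad_gain n).
have ad_up n : adapted (F n.+1) (fun w => (upcrosses a b (Z ^~ w) n)%:R : R).
  move=> w w' Fww'; congr ((nat_of_bool _)%:R); rewrite /upcrosses;
    congr (_ && ~~ _).
  - exact: (adapted_leq (leqnSn n) (@adapted_holding a b n) Fww').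
  - exact: (@adapted_holding a b n.+1 _ _ Fww').
have int_up n := adapted_integrable P (@mF n.+1) (ad_up n).
apply: (@ae_cvg_series _ _ _ _ _ (a / (b - a))) => // n.
have ba : 0 < b - a by rewrite subr_gt0.
rewrite ler_pdivlMr// mulrC -Rintegral_sum// -RintegralZl//;
  last exact: integrable_EFin_sum.
rewrite -[leRHS]addr0.
rewrite -lerBlDl.
apply: (@le_trans _ _ (\int[P]_w
    (\sum_(k < n) (holding a b (Z ^~ w) k)%:R * (Z k.+1 w - Z k w)))); last first.
  rewrite Rintegral_sum//; apply: sumr_le0 => k _; apply: superZ => // w w' Fww'.
  by congr ((nat_of_bool _)%:R); exact: (@adapted_holding a b k _ _ Fww').
have int_scaled : P.-integrable setT
    (EFin \o (fun w => (b - a) * (\sum_(k < n) (upcrosses a b (Z ^~ w) k)%:R))).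
  have := integrableZl measurableT (b - a)
    (integrable_EFin_sum (index_enum 'I_n) xpredT (fun k : 'I_n => int_up k)).
  by apply: eq_integrable.
have int_a : P.-integrable setT (EFin \o (fun=> a)).
  exact: finite_measure_integrable_cst.
rewrite [X in _ - X](_ : a = \int[P]_w a); last first.
  by rewrite Rintegral_cst //= [X in fine X]probability_setT mulr1.
rewrite -RintegralB//.
apply: le_Rintegral => //.
- by have := integrableB measurableT int_scaled int_a; apply: eq_integrable.
- exact: integrable_EFin_sum.
- by move=> w _; apply: upcrossing_gain.
Qed.

(** Almost surely no grid interval is crossed infinitely often, and the lower limit is finite
    because expectations do not increase. *)
Lemma supermartingale_cvg : {ae P, forall w, cvgn (Z ^~ w)}.
Proof.
have grid : {ae P, forall w, forall k l : nat,
    (\forall n \near \oo, Z n w < k.+1%:R / l.+1%:R) \/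
    (\forall n \near \oo, k%:R / l.+1%:R < Z n w)}.
  apply: ae_foralln => k; apply: ae_foralln => l.
  have l0 : 0 < l.+1%:R :> R by [].
  have kl : k%:R / l.+1%:R < k.+1%:R / l.+1%:R :> R.
    by rewrite ltr_pM2r ?invr_gt0// ltr_nat.
  have := ae_finite_upcrossings (divr_ge0 (ler0n _ _) (ltW l0)) kl.
  by apply: filterS => w; exact: finite_upcrossings_near.
have intZ n := adapted_integrable P (@mF n) (@adaptedZ n).
have ZC n : \int[P]_w Z n w <= \int[P]_w Z 0%N w.
  elim: n => // n; apply: le_trans.
  rewrite -subr_le0 -RintegralB//.
  under eq_Rintegral do rewrite -[_ - _]mul1r.
  by apply: (superZ (f := fun=> 1)).
have := ae_liminf_finite intZ Z_ge0 ZC.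
apply: filterS2 grid => w crossw [C bw].
exact: grid_crossings_cvg bw crossw.
Qed.

End supermartingale.

(** * Regular bipartite graphs *)

Section regular_bipartite.
Variables (m : nat) (adj : rel 'I_m) (A B : {set 'I_m}) (deg : nat).
Hypothesis hsimple : simple_graph adj.
Hypothesis hbip : bipartition adj A B.
Hypothesis hdeg : forall i, #|[set j | adj i j]%SET| = deg.

Lemma in_bipartition i : (i \in B) = (i \notin A).
Proof.
case: hbip => AUB AIB _.
have := finset.in_setT i; have : i \notin A :&: B by rewrite AIB inE.
by rewrite -AUB !inE; case: (i \in A); case: (i \in B).
Qed.

Lemma adj_bipartition i j : adj i j -> (j \in A) = (i \notin A).
Proof.
by case: hbip => _ _ h /h; rewrite !in_bipartition; case: (i \in A);
  case: (j \in A).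
Qed.

Lemma edge_in_edges i j : adj i j -> edge i j \in edges adj.
Proof. by move=> ij; rewrite inE; apply/existsP; exists i; apply/existsP;
  exists j; rewrite ij/=. Qed.

(** Every edge is the image of a pair formed by an end in [A] and a neighbour of it. *)
Lemma card_edges_le : (#|edges adj| <= #|A| * deg)%N.
Proof.
pose E' := [set edge p.1 p.2 | p in [set p : 'I_m * 'I_m | (p.1 \in A) && adj p.1 p.2]]%SET.
have sub : edges adj \subset E'.
  apply/fintype.subsetP => e; rewrite inE => /existsP[i /existsP[j /andP[ij /eqP->]]].
  apply/imsetP; have := adj_bipartition ij.
  case: (boolP (i \in A)) => iA jA; first by exists (i, j); rewrite ?inE/= ?iA.
  exists (j, i); last by rewrite /edge finset.setUC.
  by rewrite inE/= jA (proj1 hsimple).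
apply: (leq_trans (subset_leq_card sub)); apply: (leq_trans (leq_imset_card _ _)).
rewrite -sum1dep_card (eq_bigl (fun p : 'I_m * 'I_m => (p.1 \in A) && adj p.1 p.2)) //.
rewrite -(pair_big_dep (mem A) (fun i j => adj i j) (fun _ _ => 1%N))/=.
rewrite (eq_bigr (fun=> deg)); first by rewrite sum_nat_const.
by move=> i _; rewrite sum1dep_card.
Qed.

(** Double counting: a vertex of [A] occurs once for each of its [deg] neighbours, and so does a
    vertex outside [A], since all its neighbours lie in [A]. *)
Lemma sum_neighbours (R : realType) (x : 'I_m -> R) :
  \sum_(i in A) \sum_(j | adj i j) (x i + x j) = deg%:R * \sum_i x i.
Proof.
under eq_bigr do rewrite big_split/=.
rewrite big_split/= (bigID (mem A) predT)/= mulrDr; congr (_ + _).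
  rewrite mulr_sumr; apply: eq_bigr => i _.
  by rewrite sumr_const -(hdeg i) cardsE mulr_natl.
rewrite mulr_sumr (exchange_big_dep (fun j => j \notin A))/=; last first.
  by move=> i j iA /adj_bipartition ->; rewrite iA.
apply: eq_bigr => j jA.
rewrite (eq_bigl (fun i => adj j i)).
  by rewrite sumr_const -(hdeg j) cardsE mulr_natl.
move=> i; rewrite (proj1 hsimple j i).
by case: (boolP (adj i j)) => [/adj_bipartition|]; rewrite ?andbF// => h;
  move: jA; rewrite h negbK => ->.
Qed.

Lemma card_bipartition (R : realType) : (0 < deg)%N -> 2 / m%:R = #|A|%:R^-1 :> R.
Proof.
move=> deg0.
have AB : #|A| = #|~: A|.
  apply/eqP; rewrite -(eqn_pmul2r deg0) -(eqr_nat R) !natrM.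
  (* For this indicator every inner summand is 1, so both sides count the edges: by their ends in
     [A] and by their ends outside [A]. *)
  have := sum_neighbours (fun i => (i \notin A)%:R : R).
  rewrite (eq_bigr (fun=> deg%:R)); last first.
    move=> i iA; rewrite (eq_bigr (fun=> 1)).
      by rewrite sumr_const -(hdeg i) cardsE.
    by move=> j /adj_bipartition ->; rewrite iA/= add0r.
  rewrite sumr_const -[_ *+ #|A|]mulr_natl => ->; rewrite mulrC; apply/eqP;
    congr (_ * _).
  rewrite -natr_sum; congr (_%:R); rewrite -sum1_card [RHS]big_mkcond/=.
  by apply: eq_bigr => i _; rewrite finset.in_setC; case: (i \in A).
have mE : (#|A| * 2)%N = m by rewrite -[RHS]card_ord -(cardsC A) -AB muln2 addnn.
by rewrite -[in LHS]mE natrM invfM mulrCA mulfV ?mulr1// pnatr_eq0.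
Qed.

(* The tangent bound [1/y >= 2/c - y/c^2] at [c = 1/#|A|], with its remainder
   [(y - c)^2 / (c^2 y)] bounded below using [y <= 1]. *)
Lemma sum_inverse_edges_ge (R : realType) (x : 'I_m -> R) :
  (0 < #|A|)%N -> (forall i, 0 < x i) -> (forall i j, adj i j -> x i + x j <= 1) ->
  \sum_i x i = 1 ->
  #|A|%:R * #|edges adj|%:R +
    #|A|%:R ^+ 2 * \sum_(i in A) \sum_(j | adj i j) (x i + x j - #|A|%:R^-1) ^+ 2 <=
  \sum_(i in A) \sum_(j | adj i j) (x i + x j)^-1.
Proof.
move=> A0 x0 x1 sx.
have a0 : 0 < #|A|%:R :> R by rewrite ltr0n.
set a : R := #|A|%:R in a0 *.
have tangent y : 0 < y -> y <= 1 ->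
    2 * a - a ^+ 2 * y + a ^+ 2 * (y - a^-1) ^+ 2 <= y^-1.
  move=> y0 y1.
  have -> : y^-1 = 2 * a - a ^+ 2 * y + a ^+ 2 * (y - a^-1) ^+ 2 / y.
    by field; rewrite !gt_eqF.
  by rewrite lerD2l ler_peMr ?invf_ge1// mulr_ge0 ?sqr_ge0.
apply: (@le_trans _ _ (\sum_(i in A) \sum_(j | adj i j)
    (2 * a - a ^+ 2 * (x i + x j) + a ^+ 2 * (x i + x j - a^-1) ^+ 2))); last first.
  apply: ler_sum => i _; apply: ler_sum => j ij.
  by apply: tangent; [exact: addr_gt0 | exact: x1].
have -> : \sum_(i in A) \sum_(j | adj i j)
    (2 * a - a ^+ 2 * (x i + x j) + a ^+ 2 * (x i + x j - a^-1) ^+ 2) =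
    \sum_(i in A) \sum_(j | adj i j) (2 * a) -
    a ^+ 2 * \sum_(i in A) \sum_(j | adj i j) (x i + x j) +
    a ^+ 2 * \sum_(i in A) \sum_(j | adj i j) (x i + x j - a^-1) ^+ 2.
  rewrite !mulr_sumr -sumrB -big_split/=; apply: eq_bigr => i _.
  by rewrite !mulr_sumr -sumrB -big_split.
(* What remains of the tangent terms is [2 a^2 deg - a^2 deg = a (a deg)], to be compared with [a]
   times the number of edges. *)
rewrite lerD2r sum_neighbours sx mulr1.
have -> : \sum_(i in A) \sum_(j | adj i j) (2 * a) = a * deg%:R * (2 * a).
  rewrite (eq_bigr (fun=> deg%:R * (2 * a))).
    by rewrite sumr_const -[LHS]mulr_natl mulrA.
  by move=> i _; rewrite sumr_const -(hdeg i) cardsE -[LHS]mulr_natl.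
have := card_edges_le; rewrite -(ler_nat R) natrM -/a => N_le.
have -> : a * deg%:R * (2 * a) - a ^+ 2 * deg%:R = a * (a * deg%:R) by ring.
by rewrite ler_wpM2l// ltW.
Qed.

End regular_bipartite.

(** * The urn process *)

Section urn.
Variables (m : nat) (adj : rel 'I_m).
Context {d : measure_display} {T : measurableType d} {R : realType}.
Variables (P : probability T R) (B0 : 'I_m -> nat).
Variable X : nat -> {set 'I_m} -> T -> 'I_m.
Hypothesis hurn : urn_process adj P B0 X.

Local Notation nedges := #|edges adj|.
Local Notation ballsR n w i := ((balls adj B0 X n w i)%:R : R).
Local Notation totalR n := ((\sum_(j < m) B0 j + n * nedges)%N%:R : R).

(* Finitely many values, so that functions of the past are simple functions. *)
Definition allocation (n : nat) (w : T) :
    {ffun 'I_n * {set 'I_m} * 'I_m -> bool} :=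
  [ffun p : 'I_n * {set 'I_m} * 'I_m => (p.1.2 \in edges adj) && (X p.1.1.+1 p.1.2 w == p.2)].

(** The fibres of [allocation n] are thus the atoms on which [urn_law] prescribes conditional
    probabilities. Index [k] of ['I_n] stands for step [k.+1], and non-edges, where [X] is
    unconstrained, are masked. *)
Lemma allocationP n w w' :
  allocation n w = allocation n w' <-> history adj X n w' w.
Proof.
split.
  move=> ww' [//|k] e /= kn eE.
  have /ffunP/(_ (Ordinal kn, e, X k.+1 e w)) := ww'.
  by rewrite !ffunE/= eE eqxx/= => /esym/eqP.
move=> ww'; apply/ffunP => -[[k e] i]; rewrite !ffunE/=.
by case: (boolP (e \in edges adj)) => //= eE; rewrite (ww' k.+1 e) ?ltn_ord.
Qed.

Lemma measurable_allocation n k : measurable [set w | allocation n w = k].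
Proof.
rewrite (_ : mkset _ = \bigcap_(p in [set: ('I_n * {set 'I_m} * 'I_m)%type])
    [set w | allocation n w p = k p]); last first.
  apply/seteqP; split => w /=; first by move=> wk p _; rewrite /mkset wk.
  by move=> kp; apply/ffunP => p; apply: kp.
apply: fin_bigcap_measurable => [|p _]; first exact: finite_finset.
have [eE|eE] := boolP (p.1.2 \in edges adj); last first.
  case kp: (k p); [rewrite (_ : mkset _ = set0)// | rewrite (_ : mkset _ = setT)//];
    by apply/seteqP; split => w //=; rewrite ffunE (negbTE eE).
have mX := urn_measurable hurn p.2 (ltn0Sn p.1.1) eE.
case: (k p).
  rewrite (_ : mkset _ = [set w | X p.1.1.+1 p.1.2 w = p.2])//.
  by apply/seteqP; split => w /=; rewrite ffunE eE/= => /eqP.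
rewrite (_ : mkset _ = ~` [set w | X p.1.1.+1 p.1.2 w = p.2]).
  exact: measurableC.
by apply/seteqP; split => w /=; rewrite ffunE eE/=; [move/negbT/eqP | move/eqP/negbTE].
Qed.

Lemma adapted_allocation n : adapted (allocation n.+1) (allocation n).
Proof.
move=> w w' /allocationP ww'; apply/allocationP => k e /andP[k0 kn].
by apply: ww'; rewrite k0 leqW.
Qed.

Lemma adapted_balls n i : adapted (allocation n) (fun w => balls adj B0 X n w i).
Proof.
move=> w w' /allocationP ww'; rewrite /balls; congr addn.
apply: eq_big_nat => k kn; apply: eq_card => e; rewrite inE [RHS]inE.
by case: (boolP (e \in edges adj)) => //= eE; rewrite (ww' k e kn eE).
Qed.

Lemma balls_ge1 n w i : (1 <= balls adj B0 X n w i)%N.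
Proof. exact: leq_trans (urn_init hurn i) (leq_addr _ _). Qed.

Lemma sum_balls n w : \sum_i ballsR n w i = totalR n.
Proof.
rewrite -natr_sum /balls big_split/=; congr (_%:R); congr addn.
rewrite exchange_big/= (eq_bigr (fun=> nedges)).
  by rewrite sum_nat_const_nat subSS subn0.
move=> k _; rewrite -sum1_card (partition_big (X k ^~ w) xpredT)//=.
apply: eq_bigr => i _; rewrite -sum1_card; apply: eq_bigl => e.
by rewrite inE.
Qed.

Lemma balls_succ n w i : balls adj B0 X n.+1 w i =
  (balls adj B0 X n w i + #|[set e in edges adj | X n.+1 e w == i]%SET|)%N.
Proof. by rewrite /balls big_nat_recr//= addnA. Qed.

(** Distinct neighbours of [i] give distinct edges, so no received ball is counted twice. *)
Lemma sum_received_le n w i :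
  (\sum_(j | adj i j) (X n.+1 (edge i j) w == i) <=
   #|[set e in edges adj | X n.+1 e w == i]%SET|)%N.
Proof.
rewrite -big_mkcondr sum1dep_card -(card_in_imset (f := edge i)).
  apply/subset_leq_card/fintype.subsetP => e /imsetP[j]; rewrite !inE => /andP[ij Xi] ->.
  by rewrite Xi andbT; apply/existsP; exists i; apply/existsP; exists j;
    rewrite ij/=.
move=> j k _ _ /setP jk.
have := jk j; have := jk k; rewrite !inE !eqxx !orbT.
by case: (eqVneq j i) => [->|_ _ /esym/eqP//] /= /eqP; case: (eqVneq k i) => [->|_ /esym/eqP].
Qed.

(** On each atom of the past, [f] and the ratio are constant, and the claim becomes [urn_law]
    multiplied by the probability of the atom. *)
Lemma Rintegral_receives n i j (f : T -> R) : adj i j ->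
  adapted (allocation n) f ->
  \int[P]_w (f w * (X n.+1 (edge i j) w == i)%:R) =
  \int[P]_w (f w * (ballsR n w i / (ballsR n w i + ballsR n w j))).
Proof.
move=> ij adf.
have eE := edge_in_edges ij.
have ad1 : adapted (allocation n.+1) (fun w => f w * (X n.+1 (edge i j) w == i)%:R).
  move=> w w' ww'; rewrite (adf _ _ (adapted_allocation ww')).
  have /allocationP h := ww'.
  by rewrite (h n.+1)// ltn0Sn leqnn.
have adr : adapted (allocation n) (fun w => ballsR n w i / (ballsR n w i + ballsR n w j)).
  by move=> w w' ww'; rewrite !(adapted_balls _ ww').
have ad2 : adapted (allocation n) (fun w => f w * (ballsR n w i / (ballsR n w i + ballsR n w j))).
  by move=> w w' ww'; rewrite (adf _ _ ww') (adr _ _ ww').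
apply: (@eq_Rintegral_atoms _ _ _ P _ (allocation n)).
- exact: measurable_allocation.
- exact: (adapted_integrable P (@measurable_allocation n.+1) ad1).
- exact: (adapted_integrable P (@measurable_allocation n) ad2).
move=> k; set H := [set w | _].
have mH : measurable H by exact: measurable_allocation.
have [->|/set0P[w0 w0H]] := eqVneq H set0; first by rewrite !Rintegral_set0.
have HE : H = history adj X n w0.
  by apply/seteqP; split => w; rewrite /H /= -w0H => /allocationP.
set E := [set w | X n.+1 (edge i j) w = i].
have mE : measurable E by exact: (urn_measurable hurn).
transitivity (f w0 * fine (P (E `&` H))).
  rewrite (eq_Rintegral P (g := fun w => f w0 * \1_E w)); last first.
    move=> w; rewrite inE /H/= -w0H => /adf ->; congr (_ * _).
    rewrite indicE; case: eqP => Ei; first by rewrite mem_set.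
    by rewrite memNset.
  rewrite RintegralZl//; last first.
    by apply: (integrableS measurableT) => //; exact: integrable_indic.
  by congr (_ * _); rewrite /Rintegral integral_indic.
rewrite (eq_Rintegral P (g := cst (f w0 * (ballsR n w0 i / (ballsR n w0 i + ballsR n w0 j))))); last first.
  by move=> w; rewrite inE /H/= -w0H => ww0; rewrite (adf _ _ ww0) (adr _ _ ww0).
rewrite Rintegral_cst// -mulrA; congr (_ * _).
(* On a null atom [urn_law] says nothing, but both sides vanish. *)
have [PH|PH] := eqVneq (P H) 0%E.
  rewrite [X in _ * fine X]PH/= mulr0 (_ : P (E `&` H) = 0%E)//.
  apply/eqP; rewrite eq_le measure_ge0 andbT -PH.
  by apply: le_measure; rewrite ?inE//; exact: measurableI.
have := urn_law hurn ij (n := n) (w0 := w0).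
rewrite -HE => /(_ PH); rewrite /cond_prob natrD => <-.
rewrite divfK// fine_eq0//; exact: fin_num_measure.
Qed.

Variables (A : {set 'I_m}).

Definition potential (n : nat) (w : T) : R :=
  - \sum_(i in A) (ln (ballsR n w i) - nedges%:R / ballsR n w i - ln (totalR n)).

(** A lower bound for the conditional expected decrease of [potential]. Vertex [i] receives the ball
    of the edge to [j] with probability [B_i / (B_i + B_j)], which is then divided by [B_i], the
    logarithm having derivative [1 / B_i]. *)
Definition drift (n : nat) (w : T) : R :=
  \sum_(i in A) \sum_(j | adj i j) (ballsR n w i + ballsR n w j)^-1 - #|A|%:R * nedges%:R / totalR n.

Lemma balls_gt0 n w i : 0 < ballsR n w i.
Proof. by rewrite ltr0n balls_ge1. Qed.

Lemma balls_le_total n w i : ballsR n w i <= totalR n.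
Proof.
by rewrite -(sum_balls n w) (bigD1 i)//= lerDl sumr_ge0// => j _;
  exact: ltW (balls_gt0 _ _ _).
Qed.

Lemma potential_ge0 n w : 0 <= potential n w.
Proof.
rewrite oppr_ge0; apply: sumr_le0 => i _.
have b0 := balls_gt0 n w i; have bS := balls_le_total n w i.
have : ln (ballsR n w i) <= ln (totalR n) by rewrite ler_ln// posrE; lra.
have : 0 <= nedges%:R / ballsR n w i by rewrite divr_ge0// ltW.
lra.
Qed.

Lemma adapted_potential n : adapted (allocation n) (potential n).
Proof.
move=> w w' ww'; congr (- _); apply: eq_bigr => i _.
by rewrite (adapted_balls i ww').
Qed.

Lemma adapted_drift n : adapted (allocation n) (drift n).
Proof.
move=> w w' ww'; congr (_ - _); apply: eq_bigr => i _; apply: eq_bigr => j _.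
by rewrite !(adapted_balls _ ww').
Qed.

(** Holds path by path: [corrected_ln_increment_ge] bounds the gain of each vertex of [A] below by
    received balls over [B_i], and concavity bounds the increment of [ln S] above by [N / S]. *)
Lemma potential_increment n w : potential n.+1 w - potential n w <=
  - (\sum_(i in A) \sum_(j | adj i j) (X n.+1 (edge i j) w == i)%:R / ballsR n w i -
     #|A|%:R * nedges%:R / totalR n).
Proof.
rewrite -opprD lerN2 /potential.
have -> : \sum_(i in A) \sum_(j | adj i j) (X n.+1 (edge i j) w == i)%:R / ballsR n w i -
     #|A|%:R * nedges%:R / totalR n = \sum_(i in A)
   (\sum_(j | adj i j) (X n.+1 (edge i j) w == i)%:R / ballsR n w i - nedges%:R / totalR n).
  by rewrite sumrB sumr_const -[X in _ = _ - X]mulr_natl mulrA.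
rewrite -sumrB; apply: ler_sum => i iA.
have b0 := balls_gt0 n w i.
have S0 : 0 < totalR n by exact: lt_le_trans (balls_le_total n w i).
have SS : totalR n.+1 = totalR n + nedges%:R by rewrite mulSn addnCA addnC natrD.
have lnS : ln (totalR n.+1) - ln (totalR n) <= nedges%:R / totalR n.
  have -> : nedges%:R = totalR n.+1 - totalR n by rewrite SS addrC addKr.
  by apply: ln_increment_le => //; rewrite SS ltr_wpDr.
pose D := #|[set e in edges adj | X n.+1 e w == i]%SET|.
have bS : ballsR n.+1 w i = ballsR n w i + D%:R by rewrite balls_succ natrD.
have DN : 0 <= (D%:R : R) <= nedges%:R.
  rewrite ler0n ler_nat; apply/subset_leq_card/fintype.subsetP => e.
  by rewrite inE => /andP[].
have := corrected_ln_increment_ge b0 DN; rewrite -bS => lnb.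
have : \sum_(j | adj i j) (X n.+1 (edge i j) w == i)%:R / ballsR n w i <= D%:R / ballsR n w i.
  rewrite -mulr_suml ler_pM2r ?invr_gt0// -natr_sum ler_nat.
  exact: sum_received_le.
lra.
Qed.

Lemma Rintegral_potential_increment n (f : T -> R) :
  adapted (allocation n) f -> (forall w, 0 <= f w) ->
  \int[P]_w (f w * (potential n.+1 w - potential n w)) <=
  - \int[P]_w (f w * drift n w).
Proof.
move=> adf f0.
have adf' : adapted (allocation n.+1) f.
  by apply: adapted_trans adf; exact: adapted_allocation.
have adb i : adapted (allocation n) (fun w => ballsR n w i).
  by move=> w w' ww'; rewrite (adapted_balls i ww').
have intA (g : T -> R) := @adapted_integrable _ _ _ P _ _ (@measurable_allocation n.+1) g.
have adS (g : T -> R) : adapted (allocation n) g -> adapted (allocation n.+1) g.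
  by apply: adapted_trans; exact: adapted_allocation.
have adM (g h : T -> R) : adapted (allocation n.+1) g ->
    adapted (allocation n.+1) h -> adapted (allocation n.+1) (fun w => g w * h w).
  by move=> adg adh w w' ww'; rewrite (adg _ _ ww') (adh _ _ ww').
(* Extension by 0 to non-adjacent pairs makes every term integrable, as the interchange of sum and
   integral asks. For adjacent pairs the weight [f / B_i] is a function of the past, so
   [Rintegral_receives] turns [g] into [h]. *)
pose g i j w := if adj i j then f w / ballsR n w i * (X n.+1 (edge i j) w == i)%:R else 0.
pose h i j w := if adj i j then f w / ballsR n w i * (ballsR n w i / (ballsR n w i + ballsR n w j)) else 0.
have intg i j : P.-integrable setT (EFin \o g i j).
  apply: intA => w w' ww'; rewrite /g; case: ifP => // ij.
  rewrite (adf' _ _ ww') (adb i _ _ (adapted_allocation ww')).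
  have /allocationP hX := ww'.
  by rewrite (hX n.+1) ?leqnn// edge_in_edges.
have inth i j : P.-integrable setT (EFin \o h i j).
  apply: intA => w w' ww'; rewrite /h; case: ifP => // ij.
  by rewrite (adf' _ _ ww') !(adb _ _ _ (adapted_allocation ww')).
pose c w := f w * (#|A|%:R * nedges%:R / totalR n).
have intc : P.-integrable setT (EFin \o c) by apply: intA; apply: adM.
have intgi i : P.-integrable setT (EFin \o (fun w => \sum_j g i j w)).
  exact: integrable_EFin_sum.
have inthi i : P.-integrable setT (EFin \o (fun w => \sum_j h i j w)).
  exact: integrable_EFin_sum.
have gh : \int[P]_w (\sum_(i in A) \sum_j g i j w) = \int[P]_w (\sum_(i in A) \sum_j h i j w).
  rewrite Rintegral_sum// [RHS]Rintegral_sum//; apply: eq_bigr => i _.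
  rewrite Rintegral_sum// [RHS]Rintegral_sum//; apply: eq_bigr => j _.
  rewrite /g /h; case: (boolP (adj i j)) => // ij;
    apply: Rintegral_receives => // w w' ww'.
  by rewrite (adf _ _ ww') (adb i _ _ ww').
have intgs : P.-integrable setT (EFin \o (fun w => \sum_(i in A) \sum_j g i j w)).
  exact: integrable_EFin_sum.
have inths : P.-integrable setT (EFin \o (fun w => \sum_(i in A) \sum_j h i j w)).
  exact: integrable_EFin_sum.
have -> : \int[P]_w (f w * drift n w) = \int[P]_w (\sum_(i in A) \sum_j g i j w - c w).
  rewrite RintegralB// gh -RintegralB//; apply: eq_Rintegral => w _.
  rewrite /drift mulrBr mulr_sumr; congr (_ - _); apply: eq_bigr => i _.
  rewrite mulr_sumr big_mkcond/=; apply: eq_bigr => j _; rewrite /h;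
    case: ifP => // ij.
  by rewrite -mulrA mulKf// gt_eqF// balls_gt0.
rewrite -[leRHS]mulN1r -RintegralZl//; last first.
  by have := integrableB measurableT intgs intc; apply: eq_integrable.
apply: le_Rintegral => //.
- apply: intA; apply: adM => // w w' ww'; congr (_ - _);
  first exact: adapted_potential.
  exact: (adS _ (@adapted_potential n)).
- have := integrableZl measurableT (-1) (integrableB measurableT intgs intc).
  by apply: eq_integrable.
move=> w _; have := ler_wpM2l (f0 w) (potential_increment n w).
congr (_ <= _); rewrite mulrN mulN1r mulrBr; congr (- (_ - _)).
rewrite mulr_sumr; apply: eq_bigr => i _.
rewrite mulr_sumr big_mkcond/=; apply: eq_bigr => j _; rewrite /g;
  case: ifP => // ij.
by rewrite mulrA mulrAC.
Qed.

End urn.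

(** * Convergence of the proportions *)

Lemma cvg_fsum (R : realType) (I : Type) (r : seq I) (p : pred I)
    (u : I -> nat -> R) (l : I -> R) :
  (forall i, p i -> u i @ \oo --> l i) ->
  (fun n => \sum_(i <- r | p i) u i n) @ \oo --> \sum_(i <- r | p i) l i.
Proof.
move=> ul; elim: r => [|i r IH].
  rewrite big_nil; under eq_fun do rewrite big_nil; exact: cvg_cst.
rewrite big_cons; under eq_fun do rewrite big_cons.
case: ifPn => // pi; exact: cvgD (ul i pi) IH.
Qed.

Lemma cvg_rV (R : realType) (m : nat) (x : nat -> 'rV[R]_m) (l : 'rV[R]_m) :
  (forall i, (fun n => x n 0 i) @ \oo --> l 0 i) -> x @ \oo --> l.
Proof.
move=> xl; apply/cvg_ballP => e e0.
have : \forall n \near \oo, forall i, ball (l 0 i) e (x n 0 i).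
  by apply: filter_forall => i; move/cvg_ballP: (xl i); exact.
by apply: filterS => n xe; split => // i j; rewrite (ord1 i).
Qed.

(** * Limits along one sample path *)

Section path_limit.
Variables (m : nat) (adj : rel 'I_m) (A B : {set 'I_m}) (R : realType).
Hypothesis hsimple : simple_graph adj.
Hypothesis hconn : forall i j, connect adj i j.
Hypothesis hbip : bipartition adj A B.
Variables (x : nat -> 'I_m -> R) (c : R).
Hypothesis edge_cvg : forall i j, i \in A -> adj i j ->
  (fun n => x n i + x n j) @ \oo --> c.

(** Propagated from [i0] along a path of the graph: crossing an edge replaces [u j] by
    [x_j + x_k - c - u j], whichever side [j] is on. *)
Lemma cvg_side_differences i0 i : i0 \in A ->
  (fun n => if i \in A then x n i - x n i0 else x n i + x n i0 - c) @ \oo --> (0 : R).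
Proof.
move=> i0A.
pose u j n := if j \in A then x n j - x n i0 else x n j + x n i0 - c.
rewrite -/(u i).
have adj_cvg j k : adj j k -> (fun n => x n j + x n k) @ \oo --> c.
  move=> jk; have kA := adj_bipartition hbip jk.
  have [jA|jA] := boolP (j \in A); first exact: edge_cvg.
  under eq_fun do rewrite addrC.
  by apply: edge_cvg; rewrite ?kA// (proj1 hsimple).
have step j k : adj j k -> u j @ \oo --> (0 : R) -> u k @ \oo --> (0 : R).
  move=> jk cj; have kA := adj_bipartition hbip jk.
  have -> : u k = (fun n => x n j + x n k - c - u j n).
    by apply/funext => n; rewrite /u kA; case: (j \in A) => /=; ring.
  rewrite -[X in _ --> X](subr0 0) -[X in _ --> X - _](subrr c).
  by apply: cvgB cj; apply: cvgB; [exact: adj_cvg | exact: cvg_cst].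
have path_cvg p j : path adj j p -> u j @ \oo --> (0 : R) -> u (last j p) @ \oo --> (0 : R).
  by elim: p j => //= k p IH j /andP[jk kp] /(step j k jk); exact: IH.
have /connectP[p ip ->] := hconn i0 i.
apply: path_cvg => //; rewrite /u i0A.
by under eq_fun do rewrite subrr; exact: cvg_cst.
Qed.

Hypothesis x_gt0 : forall n i, 0 < x n i.
Hypothesis x_le1 : forall n i, x n i <= 1.

(** All the logarithms are at most 0, so each of them is at least their sum. *)
Lemma expR_le_of_sum_ln (n : nat) (M : R) (i : 'I_m) : i \in A ->
  - M <= \sum_(j in A) ln (x n j) -> expR (- M) <= x n i.
Proof.
move=> iA Ms; rewrite -[leRHS]lnK ?posrE// ler_expR; apply: le_trans Ms _.
rewrite (bigD1 i)//= gerDl; apply: sumr_le0 => j _; exact: ln_le0.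
Qed.

Lemma sides_cvg : (0 < #|A|)%N -> cvgn (fun n => \sum_(i in A) ln (x n i)) ->
  exists p, (forall i, i \in A -> x ^~ i @ \oo --> p) /\
            (forall i, i \notin A -> x ^~ i @ \oo --> c - p).
Proof.
move=> A0 ln_cvg; have /card_gt0P[i0 i0A] := A0.
have [M [_ HM]] := cvg_seq_bounded ln_cvg.
have M1 : M < M + 1 by rewrite ltrDl.
have x_ge n i : i \in A -> expR (- (M + 1)) <= x n i.
  move=> iA; apply: expR_le_of_sum_ln iA _.
  by have := HM (M + 1) M1 n I; rewrite /= ler_norml => /andP[].
set e := expR _ in x_ge; have e0 : 0 < e by exact: expR_gt0.
have ln_diff i : i \in A -> (fun n => ln (x n i) - ln (x n i0)) @ \oo --> (0 : R).
  move=> iA; have := cvg_side_differences i i0A; rewrite iA => /cvgrPdist_lt cd.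
  apply/cvgrPdist_lt => eps eps0.
  apply: filterS (cd _ (mulr_gt0 eps0 e0)) => n; rewrite !sub0r !normrN => lt_eps.
  apply: le_lt_trans (ln_lipschitz e0 (x_ge n i iA) (x_ge n i0 i0A)) _.
  by rewrite ltr_pdivrMr.
have /cvg_ex[/= l ln_l] := ln_cvg.
have a0 : #|A|%:R != 0 :> R by rewrite pnatr_eq0 -lt0n.
(* [ln (x n i0)] is the mean of the logarithms over [A] minus the mean of their differences from it,
   which tend to 0. *)
have ln0 : (fun n => ln (x n i0)) @ \oo --> #|A|%:R^-1 * (l - \sum_(i in A) 0).
  have -> : (fun n => ln (x n i0)) = (fun n => #|A|%:R^-1 *
      (\sum_(i in A) ln (x n i) - \sum_(i in A) (ln (x n i) - ln (x n i0)))).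
    apply/funext => n; rewrite -sumrB (eq_bigr (fun=> ln (x n i0))).
      by rewrite sumr_const -[ln _ *+ _]mulr_natl mulKf.
    by move=> i _; rewrite opprB addrC subrK.
  by apply: cvgM; [exact: cvg_cst | apply: cvgB => //; exact: cvg_fsum].
set lim := _ * _ in ln0.
have x0 : x ^~ i0 @ \oo --> expR lim.
  have -> : x ^~ i0 = (fun n => expR (ln (x n i0))).
    by apply/funext => n; rewrite lnK// posrE.
  by apply: continuous_cvg; [exact: continuous_expR | exact: ln0].
exists (expR lim); split => i iA.
  have := cvg_side_differences i i0A; rewrite iA => cd.
  rewrite (_ : x ^~ i = fun n => x n i - x n i0 + x n i0); last first.
    by apply/funext => n; rewrite subrK.
  by rewrite -[X in _ --> X]add0r; exact: cvgD.
have := cvg_side_differences i i0A; rewrite (negbTE iA) => cd.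
rewrite (_ : x ^~ i = fun n => x n i + x n i0 - c + c - x n i0); last first.
  by apply/funext => n; rewrite subrK addrK.
by rewrite -[X in _ --> X - _]add0r; apply: cvgB => //; apply: cvgD => //;
  exact: cvg_cst.
Qed.

End path_limit.

(** * The urn process on a regular bipartite graph *)

Section urn_on_regular_bipartite_graph.
Variables (m : nat) (adj : rel 'I_m) (A B : {set 'I_m}) (deg : nat).
Hypothesis hsimple : simple_graph adj.
Hypothesis hconn : forall i j, connect adj i j.
Hypothesis hdeg : forall i, #|[set j | adj i j]%SET| = deg.
Hypothesis hbip : bipartition adj A B.
Hypothesis A_gt0 : (0 < #|A|)%N.
Context {d : measure_display} {T : measurableType d} {R : realType}.
Variables (P : probability T R) (B0 : 'I_m -> nat).
Variable X : nat -> {set 'I_m} -> T -> 'I_m.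
Hypothesis hurn : urn_process adj P B0 X.

Local Notation nedges := #|edges adj|.
Local Notation totalR n := ((\sum_(j < m) B0 j + n * nedges)%N%:R : R).
Local Notation x n w i := (proportions adj R B0 X n w 0 i).
Local Notation Z := (potential (R := R) adj B0 X A).
Local Notation D := (drift (R := R) adj B0 X A).

Lemma total_balls_gt0 n : 0 < totalR n.
Proof.
have /card_gt0P[i _] := A_gt0.
rewrite ltr0n; apply: leq_trans (leq_addr _ _).
by rewrite (bigD1 i)//= (leq_trans (urn_init hurn i))// leq_addr.
Qed.

#[local] Hint Resolve total_balls_gt0 : core.

Lemma total_ballsS n : totalR n.+1 = totalR n + nedges%:R.
Proof. by rewrite mulSn addnCA addnC natrD. Qed.

Lemma proportion_gt0 n w i : 0 < x n w i.
Proof. by rewrite mxE divr_gt0//; exact: (balls_gt0 hurn). Qed.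

Lemma sum_proportions n w : \sum_i x n w i = 1.
Proof.
under eq_bigr do rewrite mxE.
by rewrite -mulr_suml sum_balls divff ?gt_eqF ?total_balls_gt0. Qed.

Lemma proportion_le1 n w i : x n w i <= 1.
Proof. by rewrite mxE ler_pdivrMr ?total_balls_gt0 ?mul1r ?balls_le_total. Qed.

Lemma adj_proportions_le1 n w i j : adj i j -> x n w i + x n w j <= 1.
Proof.
move=> ij; have ji : j != i.
  by apply/eqP => ji; move: ij; rewrite ji (proj2 hsimple).
rewrite -(sum_proportions n w) (bigD1 i)//= (bigD1 j)//= addrA lerDl.
by apply: sumr_ge0 => k _; exact: ltW (proportion_gt0 _ _ _).
Qed.

(** This is [sum_inverse_edges_ge] for the proportions, divided by the total: [1 / (B_i + B_j)] is
    [1 / (x_i + x_j)] divided by [S]. *)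
Lemma drift_ge n w :
  #|A|%:R ^+ 2 * (\sum_(i in A) \sum_(j | adj i j)
    (x n w i + x n w j - #|A|%:R^-1) ^+ 2) / totalR n <= D n w.
Proof.
have := sum_inverse_edges_ge hsimple hbip hdeg A_gt0 (proportion_gt0 n w)
  (adj_proportions_le1 n w) (sum_proportions n w).
rewrite -lerBrDl => le_xy; rewrite ler_pdivrMr ?total_balls_gt0//. apply: (le_trans le_xy).
rewrite /D /drift mulrBl divfK ?gt_eqF// lerD2r mulr_suml; apply: ler_sum => i _.
rewrite mulr_suml; apply: ler_sum => j _.
by rewrite !mxE -mulrDl invfM invrK.
Qed.

Lemma drift_ge0 n w : 0 <= D n w.
Proof.
apply: le_trans (drift_ge n w); rewrite divr_ge0 ?(ltW (total_balls_gt0 n))//.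
rewrite mulr_ge0 ?sqr_ge0//; apply: sumr_ge0 => i _; apply: sumr_ge0 => j _.
exact: sqr_ge0.
Qed.

Lemma ae_potential_cvg : {ae P, forall w, cvgn (Z ^~ w)}.
Proof.
apply: (@supermartingale_cvg _ _ _ P _ (allocation adj X)).
- by move=> n k; exact: (measurable_allocation hurn).
- exact: adapted_allocation.
- exact: adapted_potential.
- exact: (potential_ge0 hurn).
- move=> n f adf f0; apply: (le_trans (Rintegral_potential_increment hurn A adf f0)).
  by rewrite oppr_le0; apply: Rintegral_ge0 => w _; rewrite mulr_ge0// drift_ge0.
Qed.

Lemma ae_drift_summable : {ae P, forall w, cvgn (series (D ^~ w))}.
Proof.
have intZ n : P.-integrable setT (EFin \o Z n).
  apply: (@adapted_integrable _ _ _ P _ (allocation adj X n)).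
    exact: (measurable_allocation hurn).
  exact: adapted_potential.
apply: (@ae_cvg_series _ _ _ P D (\int[P]_w Z 0%N w)).
- move=> n; apply: (@adapted_integrable _ _ _ P _ (allocation adj X n)).
    exact: (measurable_allocation hurn).
  exact: adapted_drift.
- exact: drift_ge0.
move=> n; rewrite -[leRHS]addr0.
(* Keeping the integral of [Z n] on the left makes the bound telescope. *)
suff : \sum_(k < n) \int[P]_w D k w + \int[P]_w Z n w <= \int[P]_w Z 0%N w.
  rewrite addr0; apply: le_trans; rewrite lerDl.
  by apply: Rintegral_ge0 => w _; exact: (potential_ge0 hurn).
elim: n => [|n]; first by rewrite big_ord0 add0r.
apply: le_trans; rewrite big_ord_recr/= -addrA lerD2l.
have adf : adapted (allocation adj X n) (fun=> 1 : R) by [].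
have := Rintegral_potential_increment hurn A adf (fun=> ler01).
rewrite (eq_Rintegral P (g := fun w => Z n.+1 w - Z n w)) => [|w _];
  last by rewrite mul1r.
rewrite (eq_Rintegral P (f := fun w => 1 * D n w) (g := D n)) => [|w _];
  last by rewrite mul1r.
rewrite RintegralB//; lra.
Qed.

(** Multiplied by the new total, the increment is the number of received balls minus [x_i N], a
    difference of two numbers between 0 and [N]. *)
Lemma proportion_increment n w i : `|x n.+1 w i - x n w i| <= nedges%:R / totalR n.+1.
Proof.
have S0 := total_balls_gt0 n; have S1 := total_balls_gt0 n.+1;
  have SS := total_ballsS n.
have := @balls_le_total m adj _ T R B0 X n w i; have := balls_gt0 hurn n w i.
rewrite !mxE balls_succ [(balls _ _ _ _ _ _ + _)%N%:R]natrD.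
set b := (balls adj B0 X n w i)%:R; set g := #|[set e in edges adj | _]%SET|%:R => b0 bS.
have g0 : 0 <= g by rewrite /g.
have gN : g <= nedges%:R.
  rewrite ler_nat; apply/subset_leq_card/fintype.subsetP => e.
  by rewrite inE => /andP[].
have N0 : 0 <= nedges%:R :> R by [].
rewrite ler_pdivlMr// -[X in _ * X](gtr0_norm S1) -normrM mulrBl divfK ?gt_eqF//.
have -> : b / totalR n * totalR n.+1 = b + b / totalR n * nedges%:R by rewrite SS mulrDr divfK ?gt_eqF.
have q0 : 0 <= b / totalR n * nedges%:R by rewrite mulr_ge0// divr_ge0// ltW.
have q1 : b / totalR n * nedges%:R <= nedges%:R by rewrite ler_piMl// ler_pdivrMr// mul1r.
rewrite ler_norml; apply/andP; split; lra.
Qed.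

(** Comparison with the harmonic series, since [S_n <= (S_0 + N) (n + 1)]. *)
Lemma series_inv_total_dvg : ~ cvgn (series (fun n => (totalR n)^-1)).
Proof.
move=> cS; apply: (@dvg_harmonic R).
have S0 := total_balls_gt0 0%N; have SE n : totalR n = totalR 0%N + n%:R * nedges%:R.
  by rewrite mul0n addn0 natrD natrM.
apply: (@series_le_cvg _ _ (fun n => (totalR 0%N + nedges%:R) * (totalR n)^-1)).
- exact: harmonic_ge0.
- by move=> n; rewrite mulr_ge0 ?invr_ge0 ?(ltW (total_balls_gt0 n))// addr_ge0// ltW.
- move=> n; rewrite ler_pdivlMr// mulrC ler_pdivrMr ?ltr0Sn// SE -natr1 mulrDl !mulrDr.
  have := mulr_ge0 (ltW S0) (ler0n R n); have : 0 <= nedges%:R :> R by [].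
  by move=> ? ?; lra.
- exact: (@is_cvg_seriesZ _ (fun n => (totalR n)^-1)).
Qed.

Lemma adj_proportions_cvg w i j : cvgn (series (D ^~ w)) -> i \in A -> adj i j ->
  (fun n => x n w i + x n w j) @ \oo --> (#|A|%:R^-1 : R).
Proof.
move=> cD iA ij; set c : R := _^-1.
pose z n := x n w i + x n w j - c.
suff z0 : z @ \oo --> (0 : R).
  rewrite (_ : (fun n => _) = fun n => z n + c); last first.
    by apply/funext => n; rewrite subrK.
  by rewrite -[X in _ --> X]add0r; apply: cvgD => //; exact: cvg_cst.
apply: (@cvg0_of_slow_increments R z (fun n => totalR n) (nedges%:R + nedges%:R)) => //.
- by move=> n; rewrite total_ballsS lerDl.
- move=> n; rewrite mulrDl /z.
  have -> : x n.+1 w i + x n.+1 w j - c - (x n w i + x n w j - c) =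
    (x n.+1 w i - x n w i) + (x n.+1 w j - x n w j) by ring.
  by apply: (le_trans (ler_normD _ _)); rewrite lerD// proportion_increment.
- have a0 : 0 < #|A|%:R :> R by rewrite ltr0n.
  apply: (series_le_cvg _ _ _ (@is_cvg_seriesZ _ _ (#|A|%:R ^- 2) cD)) => n.
  + by rewrite divr_ge0 ?sqr_ge0// ltW.
  + by rewrite mulr_ge0 ?drift_ge0// invr_ge0 exprn_ge0// ltW.
  (* The square for the edge [{i, j}] is one of the nonnegative terms in [drift_ge]. *)
  rewrite -ler_pdivrMl ?invr_gt0 ?exprn_gt0// invrK; apply: le_trans (drift_ge n w).
  rewrite mulrA ler_pM2r ?invr_gt0// ler_pM2l ?exprn_gt0//.
  rewrite (bigD1 i)//= (bigD1 j)//= -addrA lerDl addr_ge0//.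
    by apply: sumr_ge0 => k _; exact: sqr_ge0.
  by apply: sumr_ge0 => k _; apply: sumr_ge0 => l _; exact: sqr_ge0.
- exact: series_inv_total_dvg.
Qed.

(** The corrections [N / B_i] must be shown to vanish. Being nonnegative, they do not spoil the
    lower bound on the sum of logarithms given by the boundedness of [Z]; so [x_i] stays away from 0
    and [N / B_i] is at most a constant times [N / S]. *)
Lemma sum_ln_proportions_cvg w : cvgn (Z ^~ w) -> cvgn (fun n => \sum_(i in A) ln (x n w i)).
Proof.
move=> cZ; have b0 n i := balls_gt0 hurn n w i.
have ln_x n i : ln (x n w i) = ln (balls adj B0 X n w i)%:R - ln (totalR n).
  by rewrite mxE ln_div ?posrE.
have ZE n : \sum_(i in A) ln (x n w i) =
    - Z n w + \sum_(i in A) nedges%:R / (balls adj B0 X n w i)%:R.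
  rewrite /Z /potential opprK -big_split/=; apply: eq_bigr => i _.
  by rewrite ln_x; ring.
have [M [_ HM]] := cvg_seq_bounded cZ.
have M1 : M < M + 1 by rewrite ltrDl.
have x_ge n i : i \in A -> expR (- (M + 1)) <= x n w i.
  move=> iA; apply: (expR_le_of_sum_ln (x := fun n i => x n w i) _ _ iA) => [k j|k j|] /=;
    [exact: proportion_gt0 | exact: proportion_le1 |].
  rewrite ZE; have := HM (M + 1) M1 n I; rewrite /= ler_norml => /andP[_ ZM].
  have : 0 <= \sum_(i in A) nedges%:R / (balls adj B0 X n w i)%:R :> R by apply: sumr_ge0.
  lra.
have e0 : 0 < expR (- (M + 1)) :> R by exact: expR_gt0.
have NS : (fun n => nedges%:R / totalR n) @ \oo --> (0 : R).
  rewrite -cvg_shiftS.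
  apply: (@squeeze_cvgr _ _ _ _ (cst 0) (@harmonic R)); [|exact: cvg_cst|exact: cvg_harmonic].
  apply: nearW => n; rewrite divr_ge0 ?(ltW (total_balls_gt0 _))//= ler_pdivrMr// mulrC.
  rewrite ler_pdivlMr ?ltr0Sn// natrD natrM mulrC lerDr.
  by rewrite ler0n.
have Nb i : i \in A -> (fun n => nedges%:R / (balls adj B0 X n w i)%:R) @ \oo --> (0 : R).
  move=> iA.
  apply: (@squeeze_cvgr _ _ _ _ (cst 0) (fun n => (expR (- (M + 1)))^-1 * (nedges%:R / totalR n))).
  - apply: nearW => n; rewrite divr_ge0//= mulrCA ler_wpM2l// -invfM lef_pV2 ?posrE ?mulr_gt0//.
    by rewrite -ler_pdivlMr//; have := x_ge n i iA; rewrite mxE.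
  - exact: cvg_cst.
  - by rewrite -[X in _ --> X](mulr0 (expR (- (M + 1)))^-1); apply: cvgM NS;
    exact: cvg_cst.
have /cvg_ex[/= l Zl] := cZ.
apply/cvg_ex; exists (- l + \sum_(i in A) 0).
under eq_fun do rewrite ZE.
by apply: cvgD; [exact: cvgN | exact: cvg_fsum].
Qed.

Lemma ae_sides_cvg : {ae P, forall w, exists p : R,
  (forall i, i \in A -> (fun n => x n w i) @ \oo --> p) /\
  (forall i, i \notin A -> (fun n => x n w i) @ \oo --> (#|A|%:R^-1 - p : R))}.
Proof.
apply: filterS2 ae_potential_cvg ae_drift_summable => w cZ cD.
apply: (sides_cvg hsimple hconn hbip (x := fun n i => x n w i)) => [i j|n i|n i||].
- exact: adj_proportions_cvg.
- exact: proportion_gt0.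
- exact: proportion_le1.
- exact: A_gt0.
- exact: sum_ln_proportions_cvg.
Qed.

End urn_on_regular_bipartite_graph.

(** * Identification of the limit as a point of [Omega] *)

Lemma cvg_ge0 (R : realType) (u : nat -> R) (l : R) :
  (forall n, 0 <= u n) -> u @ \oo --> l -> 0 <= l.
Proof.
move=> u0 ul; rewrite -(cvg_lim _ ul)//.
by apply: limr_ge; [exact: cvgP ul | exact: nearW].
Qed.

Theorem theorem1p2 (m : nat) (adj : rel 'I_m) (A B : {set 'I_m})
    (hsimple : simple_graph adj) (hconn : connected_graph adj)
    (hreg : regular_graph adj) (hbip : bipartition adj A B)
    (d : measure_display) (T : measurableType d) (R : realType)
    (P : probability T R) (B0 : 'I_m -> nat)
    (X : nat -> {set 'I_m} -> T -> 'I_m)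
    (hurn : urn_process adj P B0 X) :
  {ae P, forall w, exists2 x : 'rV[R]_m, Omega A B x &
    (fun n => proportions adj R B0 X n w) @ \oo --> x}.
Proof.
(* A single vertex has no edge and its proportion is constantly 1; [p = q = 1] fits [2 / m = 2],
   whichever side is empty. *)
have [m1|m_ne1] := eqVneq m 1%N.
  subst m; apply: aeW => w; exists (\row_(i < 1) 1).
    by exists 1, 1; split => //; [rewrite divr1 | move=> i _; rewrite mxE..].
  apply: cvg_rV => i; rewrite mxE.
  rewrite (_ : (fun n => _) = fun=> 1); first exact: cvg_cst.
  apply/funext => n; rewrite mxE -(sum_balls adj B0 X n w) big_ord1 (ord1 i) divff//.
  by rewrite pnatr_eq0 -lt0n (balls_ge1 hurn).
have [m_gt0 conn] := hconn; have [deg hdeg] := hreg.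
have [i0 [j0 adj0]] : exists i0 j0, adj i0 j0.
  have m1 : (1 < m)%N by rewrite ltn_neqAle eq_sym m_ne1.
  have /connectP[[|k p] /=] := conn (Ordinal m_gt0) (Ordinal m1).
    by move=> _ /(congr1 val).
  by move=> /andP[h _] _; exists (Ordinal m_gt0), k.
have deg_gt0 : (0 < deg)%N.
  by rewrite -(hdeg i0); apply/card_gt0P; exists j0; rewrite inE.
(* A vertex on each side shows that both limits, [p] and [#|A|%:R^-1 - p], are limits of nonnegative
   proportions. *)
have [i1 [j1 [i1A j1A]]] : exists i1 j1, i1 \in A /\ j1 \notin A.
  have := adj_bipartition hbip adj0.
  by case: (boolP (i0 \in A)) => i0A j0A; [exists i0, j0 | exists j0, i0];
    rewrite j0A.
have A_gt0 : (0 < #|A|)%N by apply/card_gt0P; exists i1.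
have := ae_sides_cvg hsimple conn hdeg hbip A_gt0 hurn.
apply: filterS => w [p [cA cB]].
have x_ge0 n i : 0 <= proportions adj R B0 X n w 0 i.
  by rewrite mxE divr_ge0.
exists (\row_i if i \in A then p else #|A|%:R^-1 - p).
  exists p, (#|A|%:R^-1 - p); split.
  - exact: cvg_ge0 (x_ge0 ^~ i1) (cA i1 i1A).
  - exact: cvg_ge0 (x_ge0 ^~ j1) (cB j1 j1A).
  - by rewrite (card_bipartition hsimple hbip hdeg)// addrC subrK.
  - by move=> i iA; rewrite mxE iA.
  - by move=> i; rewrite mxE (in_bipartition hbip) => /negbTE ->.
apply: cvg_rV => i; rewrite mxE; case: ifPn; [exact: cA | exact: cB].
Qed.
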